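(* (1) Let $\lambda_1,\lambda_2$ be real-valued $C^1$ functions such that the difference $\lambda_1-\lambda_2$ is constant, and put $$\alpha=\frac{\lambda_1+\lambda_2+\sqrt{(\lambda_1-\lambda_2)^2+4}}{2},\qquad \beta=\frac{\lambda_1+\lambda_2-\sqrt{(\lambda_1-\lambda_2)^2+4}}{2}.$$ Then for every $u\in\mathcal{B}_{\lambda_1}+\mathcal{B}_{\lambda_2}$ the pair $(u,B)=(u,-\nabla\times u+\alpha u)$ satisfies $$B+\nabla\times u=\alpha u,\qquad u-\nabla\times B=-\beta B ,$$ and likewise for every $B\in\mathcal{B}_{\lambda_1}+\mathcal{B}_{\lambda_2}$ the pair $(u,B)=(\nabla\times B-\beta B,B)$ satisfies these two equations. (2) Let $\alpha,\beta$ be real-valued $C^1$ functions such that the difference $\alpha-\beta$ is constant and $|\alpha-\beta|>2$, so that $$\lambda_1=\frac{\alpha+\beta+\sqrt{(\alpha-\beta)^2-4}}{2},\qquad \lambda_2=\frac{\alpha+\beta-\sqrt{(\alpha-\beta)^2-4}}{2}$$ are two distinct real-valued functions. Then every double Beltrami state $(u,B)$ with factors $\alpha,\beta$ is a superposition of two Beltrami flows with factors $\lambda_1,\lambda_2$; that is, $u\in\mathcal{B}_{\lambda_1}+\mathcal{B}_{\lambda_2}$ and $B\in\mathcal{B}_{\lambda_1}+\mathcal{B}_{\lambda_2}$. (3) Let $\alpha,\beta$ be real-valued $C^1$ functions such that the difference $\alpha-\beta$ is constant and $|\alpha-\beta|=2$, and let $\lambda=(\alpha+\beta)/2$. Then every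 double Beltrami state $(u,B)$ with factors $\alpha,\beta$ in $\Omega=\mathbb{T}^3$ or $\Omega=\Omega_0$ satisfies $u\in\mathcal{B}_{\lambda}$ and $B\in\mathcal{B}_{\lambda}$.
   Context: All functions and vector fields are real and defined on a common domain (an open subset of $\mathbb{R}^3$, or $\mathbb{T}^3=[-\pi,\pi]^3$ with periodic boundary conditions); parts (1) and (2) hold on any such domain. In part (3), $\Omega_0$ denotes an open and bounded domain of $\mathbb{R}^3$ with zero boundary condition, i.e. the vector fields $u,B$ are $C^1$ up to the boundary and vanish on $\partial\Omega_0$. For a real-valued function $\lambda$ (possibly $\lambda=0$), $\mathcal{B}_\lambda=\{u\in C^1:\ \nabla\times u=\lambda u,\ \operatorname{div}u=0\}$. For two sets of vector fields, $X+Y=\{a+b: a\in X,\ b\in Y\}$. A double Beltrami state with factors $\alpha,\beta$ (non-zero scalar functions) is a pair $(u,B)$ of divergence-free $C^1$ vector fields satisfying $B+\nabla\times u=\alpha u$ and $u-\nabla\times B=-\beta B$. *)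

(* Defs.v *)
From HB Require Import structures.
From mathcomp Require Import all_boot all_order all_algebra.
From mathcomp Require Import all_classical all_reals all_analysis.
Set Implicit Arguments.
Unset Strict Implicit.
Unset Printing Implicit Defensive.
Import Order.TTheory GRing.Theory Num.Theory.
Import numFieldNormedType.Exports.
Local Open Scope classical_set_scope.
Local Open Scope ring_scope.

(* Scalar and vector fields are total functions on 'rV[R]_3; only their values
   at the points of the domain matter. *)

Definition basis3 {R : realType} (i : 'I_3) : 'rV[R]_3 := delta_mx 0 i.

(* Either an open subset of R^3, or the torus [-pi, pi]^3 with periodic boundary
   conditions; functions on the torus are encoded as functions on R^3 that are
   2pi-periodic in each coordinate. *)
Inductive domain (R : realType) :=
| OpenSet (U : set 'rV[R]_3) of open U
| Torus.
Arguments OpenSet {R}.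
Arguments Torus {R}.

Definition points {R : realType} (D : domain R) : set 'rV[R]_3 :=
  match D with OpenSet U _ => U | Torus => setT end.

Definition periodic_if_torus {R : realType} {V : zmodType} (D : domain R)
    (f : 'rV[R]_3 -> V) : Prop :=
  match D with
  | OpenSet _ _ => True
  | Torus => forall i, periodic f ((2 * pi) *: basis3 i)
  end.

Definition C1 {R : realType} {V : normedModType R} (D : domain R)
    (f : 'rV[R]_3 -> V) : Prop :=
  periodic_if_torus D f /\
  (forall x, points D x -> differentiable f x /\
     forall i, {for x, continuous (fun y => 'D_(basis3 i) f y)}).

(* [partial i j u] is the derivative in the i-th variable of the j-th
   component of u. *)
Definition partial {R : realType} (i j : 'I_3) (u : 'rV[R]_3 -> 'rV[R]_3)
    (x : 'rV[R]_3) : R :=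
  'D_(basis3 i) (fun y => u y 0 j) x.

(* Indices are taken in 'I_3 = Z/3Z, i.e.
   (d_1 u_2 - d_2 u_1, d_2 u_0 - d_0 u_2, d_0 u_1 - d_1 u_0). *)
Definition curl {R : realType} (u : 'rV[R]_3 -> 'rV[R]_3) (x : 'rV[R]_3) :
    'rV[R]_3 :=
  \row_(i < 3) (partial (i + 1) (i + 2%:R) u x - partial (i + 2%:R) (i + 1) u x).

Definition divergence {R : realType} (u : 'rV[R]_3 -> 'rV[R]_3) (x : 'rV[R]_3) :
    R :=
  \sum_(i < 3) partial i i u x.

Definition beltrami {R : realType} (D : domain R) (lambda : 'rV[R]_3 -> R) :
    set ('rV[R]_3 -> 'rV[R]_3) :=
  [set u | C1 D u /\
     forall x, points D x -> curl u x = lambda x *: u x /\ divergence u x = 0].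

Definition sumset {R : realType} (D : domain R)
    (X Y : set ('rV[R]_3 -> 'rV[R]_3)) : set ('rV[R]_3 -> 'rV[R]_3) :=
  [set u | exists a b,
     [/\ X a, Y b & forall x, points D x -> u x = a x + b x]].

(* The C1 requirements are what gives both curls their classical meaning. *)
Definition double_beltrami_eqs {R : realType} (D : domain R)
    (alpha beta : 'rV[R]_3 -> R) (u B : 'rV[R]_3 -> 'rV[R]_3) : Prop :=
  [/\ C1 D u, C1 D B
    & forall x, points D x ->
        B x + curl u x = alpha x *: u x /\
        u x - curl B x = - (beta x *: B x)].

Definition not_identically_zero {R : realType} (D : domain R)
    (f : 'rV[R]_3 -> R) : Prop :=
  exists2 x, points D x & f x != 0.

Definition double_beltrami_state {R : realType} (D : domain R)
    (alpha beta : 'rV[R]_3 -> R) (u B : 'rV[R]_3 -> 'rV[R]_3) : Prop :=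
  [/\ not_identically_zero D alpha, not_identically_zero D beta,
      (forall x, points D x -> divergence u x = 0 /\ divergence B x = 0)
    & double_beltrami_eqs D alpha beta u B].

Definition constant_on {R : realType} (D : domain R) (f : 'rV[R]_3 -> R) : Prop :=
  exists c, forall x, points D x -> f x = c.

(* u and its first derivatives extend continuously from U to its closure. *)
Definition C1_up_to_boundary {R : realType} (U : set 'rV[R]_3)
    (u : 'rV[R]_3 -> 'rV[R]_3) : Prop :=
  {within closure U, continuous u} /\
  forall i, exists2 g : 'rV[R]_3 -> 'rV[R]_3,
    {within closure U, continuous g} & forall x, U x -> 'D_(basis3 i) u x = g x.

(* For an open set U, the boundary is closure U `\` U. *)
Definition zero_boundary {R : realType} (U : set 'rV[R]_3)
    (u : 'rV[R]_3 -> 'rV[R]_3) : Prop :=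
  C1_up_to_boundary U u /\ forall x, (closure U `\` U) x -> u x = 0.

Definition torus_or_zero_boundary {R : realType} (D : domain R)
    (u B : 'rV[R]_3 -> 'rV[R]_3) : Prop :=
  match D with
  | Torus => True
  | OpenSet U _ => [/\ bounded_set U, zero_boundary U u & zero_boundary U B]
  end.

(* Main.v *)
Require Import Defs.
From HB Require Import structures.
From mathcomp Require Import all_boot all_order all_algebra.
From mathcomp Require Import all_classical all_reals all_analysis.
From mathcomp Require Import ring lra.
Import Order.TTheory GRing.Theory Num.Theory.
Import numFieldNormedType.Exports.
Local Open Scope classical_set_scope.
Local Open Scope ring_scope.

Set Implicit Arguments.
Unset Strict Implicit.
Unset Printing Implicit Defensive.

(* Since lambda1 - lambda2 (resp. alpha - beta) is constant, all the combinations
   of u and B in parts (1) and (2) have constant coefficients p, q with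
   p * q = 1, and curl and div act on them linearly.

   In part (3), put p = (alpha - beta) / 2, so p^2 = 1. The equations give
   div (B x u) = u . curl B - B . curl u = |p u - B|^2 >= 0. The integral of
   div (B x u) vanishes, hence B = p u and both fields are Beltrami with factor
   lambda. Integration is replaced by Riemann sums: over a grid on a period box
   the difference quotients sum to 0 exactly, and they approximate the divergence
   uniformly. For a bounded open set the field B x u is first extended by 0; it
   is quadratic in functions that are Lipschitz at the boundary and vanish there,
   so the extension is still continuously differentiable. *)

(** * Riemann sums of a nonnegative divergence *)

(** Both difference quotients are the same function of [h]; this turns directional derivatives into
    one-variable ones, to which the mean value theorem applies. *)
Lemma derive_line (R : realType) (V : normedModType R) (f : V -> R) (x v : V)
    (s : R) :
  derivable f (x + s *: v) v ->
  is_derive s 1 (fun r : R => f (x + r *: v)) ('D_v f (x + s *: v)).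
Proof.
move=> df; have E : (fun h : R => h^-1 *:
    (((fun r => f (x + r *: v)) \o shift s) (h *: 1) - f (x + s *: v))) =
  (fun h : R => h^-1 *: ((f \o shift (x + s *: v)) (h *: v) - f (x + s *: v))).
  apply/funext => h /=; congr (_ *: (f _ - _)).
  by rewrite [h *: 1]mulr1 scalerDl addrCA.
by apply: DeriveDef; rewrite /derivable /derive E.
Qed.

Lemma derivable_line_continuous (R : realType) (V : normedModType R)
    (f : V -> R) (x v : V) :
  (forall y, derivable f y v) -> continuous (fun r : R => f (x + r *: v)).
Proof.
move=> df r; apply/differentiable_continuous/derivable1_diffP.
by have [] := derive_line (df (x + r *: v)).
Qed.

(** Around each point, the mean value theorem along [v] and the continuity of the derivative give
    the estimate for nearby base points and small [t]. Compactness of [K], in its near-covering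
    form, makes the threshold on [t] uniform. *)
Lemma uniform_difference_quotient (R : realType) (V : normedModType R)
    (f : V -> R) (v : V) (K : set V) (eta : R) :
  compact K -> (forall x, derivable f x v) -> continuous ('D_v f) -> 0 < eta ->
  \forall t \near 0^'+, forall x, K x ->
    `|f (x + t *: v) - f x - t * 'D_v f x| <= eta * t.
Proof.
move=> /compact_near_coveringP cK df cDf eta0; apply: cK => x _.
have e20 : 0 < eta / 2 by rewrite divr_gt0.
have /cvgrPdist_le/(_ _ e20) /nbhs_ballP[r /= r0 xr] := cDf x.
(* Half of the radius is spent on moving from [x] to [y], the other half on moving along [v]. *)
pose d := r / 2; have d0 : 0 < d by rewrite divr_gt0.
(* The added 1 allows division even when [v] is 0. *)
have v1 : 0 < `|v| + 1 by rewrite ltr_wpDl.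
near=> y t => /=.
have t0 : 0 < t by near: t; exact: nbhs_right_gt.
have yx : `|x - y| < d.
  near: y; apply/nbhs_ballP; exists d => //= z; by rewrite -ball_normE.
have tv : t * `|v| < d.
  apply: le_lt_trans (_ : t * (`|v| + 1) < d).
    by rewrite ler_wpM2l ?(ltW t0)// lerDl.
  by rewrite -ltr_pdivlMr// ; near: t; apply: nbhs_right_lt; rewrite divr_gt0.
have close s : 0 <= s <= t -> `|'D_v f x - 'D_v f (y + s *: v)| <= eta / 2.
  move=> /andP[s0 st]; apply: xr; rewrite -ball_normE /= opprD addrA.
  apply: le_lt_trans (ler_normB _ _) _.
  rewrite normrZ ger0_norm// (splitr r) ltrD//.
  by apply: le_lt_trans tv; rewrite ler_wpM2r.
have [c] := @MVT_segment R (fun s => f (y + s *: v)) (fun s => 'D_v f (y + s *: v))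
  0 t (ltW t0) (fun s _ => derive_line (df _))
  (continuous_subspaceT (derivable_line_continuous df)).
rewrite in_itv /= => c0t; rewrite scale0r addr0 subr0 => ->.
rewrite [t * _]mulrC -mulrBl normrM [`|t|]gtr0_norm// ler_wpM2r ?(ltW t0)//.
(* Both derivatives are compared with the one at [x], at a cost of [eta / 2] each. *)
have -> : 'D_v f (y + c *: v) - 'D_v f y =
  ('D_v f x - 'D_v f (y + 0 *: v)) - ('D_v f x - 'D_v f (y + c *: v)).
  by rewrite scale0r addr0; ring.
apply: le_trans (ler_normB _ _) _; rewrite (splitr eta) lerD// close//.
by rewrite lexx ltW.
Unshelve. all: by end_near. Qed.

Lemma rV_norm_le (R : realType) (n : nat) (v : 'rV[R]_n) (e : R) :
  0 <= e -> (forall i, `|v 0 i| <= e) -> `|v| <= e.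
Proof.
move=> e0 ve; rewrite [leLHS]/Num.Def.normr/= mx_normrE bigmax_le//.
by move=> [i j] _; rewrite (ord1 i).
Qed.

(** The cyclic successor in one coordinate permutes the grid. This is the discrete form of a total
    derivative having zero integral over a period. *)
Lemma sum_cyclic_shift (R : zmodType) (I : finType) (N : nat) (d : I)
    (f : {ffun I -> 'I_N} -> R) :
  \sum_(a : {ffun I -> 'I_N}) f [ffun i => if i == d then ordS (a i) else a i] =
  \sum_a f a.
Proof.
pose h (a : {ffun I -> 'I_N}) := [ffun i => if i == d then ordS (a i) else a i].
rewrite [RHS](reindex_inj (h := h))//.
move=> a b /ffunP ab; apply/ffunP => i; have := ab i; rewrite !ffunE.
by case: eqP => // _; exact: ordS_inj.
Qed.

(* The Riemann sums of the divergence over finer and finer grids tend to 0,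
   because the sums of the difference quotients vanish by cyclic summation; a
   positive value at [x0] would bound them away from 0. *)
Lemma periodic_nonneg_divergence_eq0 (R : realType) (n : nat)
    (F : 'I_n.+1 -> 'rV[R]_n.+1 -> R) (x0 : 'rV[R]_n.+1) (L : R) :
  0 < L ->
  (forall i x, derivable (F i) x (delta_mx 0 i)) ->
  (forall i, continuous ('D_(delta_mx 0 i) (F i))) ->
  (forall i (x : 'rV[R]_n.+1), x 0 i = x0 0 i - L ->
     F i (x + (2 * L) *: delta_mx 0 i) = F i x) ->
  (forall x, 0 <= \sum_i 'D_(delta_mx 0 i) (F i) x) ->
  \sum_i 'D_(delta_mx 0 i) (F i) x0 = 0.
Proof.
move=> L0 dF cF pF; set G := fun x => \sum_i 'D_(delta_mx 0 i) (F i) x.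
rewrite -/(G x0) => G0; apply/eqP/negPn/negP => Gx0.
have {Gx0} e0 : 0 < G x0 by rewrite lt_def Gx0 G0.
set e := G x0 in e0; have e20 : 0 < e / 2 by rewrite divr_gt0.
have cG : {for x0, continuous G}.
  apply: (continuous_big (op := +%R)) => [|i _]; last exact: cF.
  exact: add_continuous.
have [del /= del0 Gdel] : exists2 del, 0 < del &
    forall x, `|x0 - x| < del -> e / 2 <= G x.
  have /cvgrPdist_le/(_ _ e20) /nbhs_ballP[r /= r0 xr] := cG.
  exists r => // x xr0; have := xr x; rewrite -ball_normE /= => /(_ xr0).
  rewrite -/e ler_norml => /andP[_]; rewrite lerBlDr [X in X <= _ -> _](splitr e).
  by rewrite lerD2l.
(* The box has half-side [L]; [M] is such that a cube of side [L / M] with corner [x0] lies where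
   [G] is at least [e / 2]. *)
pose M := (Num.truncn (L / del)).+1.
have M0 : 0 < M%:R :> R by rewrite ltr0n.
have LM : L / M%:R < del.
  by rewrite ltr_pdivrMr// mulrC -ltr_pdivrMr// truncnS_gt.
(* This value makes the final upper bound [k ^ n.+1 * (e / 4)], half of the lower bound. It depends
   on [M] but not on the mesh, which is chosen afterwards. *)
pose eta : R := e / 4 / ((2 * M%:R) ^+ n.+1 * n.+1%:R).
have eta0 : 0 < eta by rewrite !divr_gt0// mulr_gt0// exprn_gt0// mulr_gt0.
(* The norm on row vectors is the sup norm, so this ball is the box of half-side [L] around [x0]. *)
pose K := [set x : 'rV[R]_n.+1 | closed_ball x0 L x].
have cK : compact K.
  apply: bounded_closed_compact; last exact: closed_ball_closed.
  exists (`|x0| + L); split; first exact: num_real.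
  move=> r rL x; rewrite /K /= closed_ballE// /closed_ball_ /= => xL.
  rewrite (le_trans _ (ltW rL))// -[x in leLHS](subKr x0).
  by rewrite (le_trans (ler_normB _ _))// lerD2l.
have [r r0 Hr] : exists2 r, 0 < r & forall t, 0 < t < r -> forall i x, K x ->
    `|F i (x + t *: delta_mx 0 i) - F i x - t * 'D_(delta_mx 0 i) (F i) x|
      <= eta * t.
  have : \forall t \near 0^'+, forall i x, K x ->
    `|F i (x + t *: delta_mx 0 i) - F i x - t * 'D_(delta_mx 0 i) (F i) x|
      <= eta * t.
    by apply: filter_forall => i; exact: uniform_difference_quotient.
  move=> [r /= r0 Hr]; exists r => // t /andP[t0 tr]; apply: Hr => //=.
  by rewrite sub0r normrN gtr0_norm.
(* Each side [L / M] is cut into [k] steps, enough for the mesh [t] to fall below [r]. The period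
   [2 * L] then has [N = 2 * M * k] steps, and index [M * k] is the coordinate of [x0]. *)
pose k := (Num.truncn (L / M%:R / r)).+1.
have k0 : 0 < k%:R :> R by rewrite ltr0n.
pose t := L / M%:R / k%:R.
have t0 : 0 < t by rewrite !divr_gt0.
have tr : t < r by rewrite ltr_pdivrMr// [r * _]mulrC -ltr_pdivrMr// truncnS_gt.
have tL : t * k%:R * M%:R = L by rewrite /t; field; rewrite !gt_eqF.
pose N := (2 * M * k)%N.
have NL : N%:R * t = 2 * L by rewrite /N !natrM -tL; ring.
pose X (a : {ffun 'I_n.+1 -> 'I_N}) : 'rV[R]_n.+1 :=
  \row_d (x0 0 d - L + (a d)%:R * t).
have KX a : K (X a).
  rewrite /K /= closed_ballE// /closed_ball_ /=.
  apply: rV_norm_le (ltW L0) _ => d; rewrite !mxE.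
  have : (a d)%:R * t <= 2 * L.
    by rewrite -NL ler_wpM2r ?(ltW t0)// ler_nat ltnW.
  have : 0 <= (a d)%:R * t by rewrite mulr_ge0// ltW.
  by move=> *; rewrite ler_norml; lra.
(* Away from the last index the cyclic successor is a step of length [t]. At the last index it wraps
   to 0, and the step lands on the opposite face, where [F d] has the same value. *)
have shiftX (a : {ffun 'I_n.+1 -> 'I_N}) d :
    F d (X [ffun i => if i == d then ordS (a i) else a i]) =
    F d (X a + t *: delta_mx 0 d).
  set b := finfun _.
  have [adN|adN] := eqVneq (a d).+1 N; last first.
    congr F; apply/rowP => i; rewrite !mxE ffunE eqxx /= eq_sym.
    have [->|_] := eqVneq i d; last by rewrite mulr0 addr0.
    rewrite /= modn_small; last by rewrite ltn_neqAle adN ltn_ord.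
    by rewrite mulr1 -natr1; ring.
  rewrite -pF; last by rewrite mxE ffunE eqxx /= adN modnn mul0r addr0.
  congr F; apply/rowP => i; rewrite !mxE ffunE eqxx /= eq_sym.
  have [->|_] := eqVneq i d; last by rewrite !mulr0.
  have adN1 : (a d)%:R + 1 = N%:R :> R by rewrite natr1 adN.
  by rewrite /= adN modnn -NL -adN1; ring.
(* Each derivative times [t] is at most a difference plus [eta * t]; the differences cancel over the
   grid and only the errors remain. *)
have up : \sum_a G (X a) <= (N ^ n.+1)%:R * (n.+1%:R * eta).
  rewrite -(ler_pM2l t0) big_distrr /=.
  have -> : t * ((N ^ n.+1)%:R * (n.+1%:R * eta)) =
    \sum_(a : {ffun 'I_n.+1 -> 'I_N}) \sum_(d < n.+1)
      (F d (X a + t *: delta_mx 0 d) - F d (X a) + eta * t).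
    under eq_bigr do rewrite big_split /= sumr_const card_ord.
    rewrite big_split /= sumr_const card_ffun !card_ord exchange_big /= big1.
      by rewrite add0r -[_ *+ (N ^ _)]mulr_natl -[_ *+ n.+1]mulr_natl; ring.
    move=> d _; rewrite sumrB; under eq_bigr do rewrite -shiftX.
    by rewrite (sum_cyclic_shift d (fun a => F d (X a))) subrr.
  apply: ler_sum => a _; rewrite big_distrr /=; apply: ler_sum => d _.
  have := Hr t _ d (X a) (KX a); rewrite t0 tr => /(_ isT).
  by rewrite ler_norml => /andP[H _]; lra.
(* The indices [M * k + i] with [i < k] describe the subcube with corner [x0]. Its [k ^ n.+1] grid
   points give the lower bound, since [G] is nonnegative at the others. *)
have emb (i : 'I_k) : (M * k + i < N)%N.
  by rewrite /N mul2n -addnn mulnDl ltn_add2l (leq_trans (ltn_ord i))// leq_pmull.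
pose A := codom (fun i : 'I_k => Ordinal (emb i)).
have cA : #|A| = k.
  rewrite card_codom ?card_ord// => i j /(congr1 val) /= /addnI ij.
  exact: val_inj.
have lo : (k ^ n.+1)%:R * (e / 2) <= \sum_a G (X a).
  rewrite (bigID (mem (ffun_on A))) /= -[leLHS]addr0 lerD//; last first.
    by apply: sumr_ge0 => a _; exact: G0.
  rewrite mulr_natl -[X in (X ^ _)%N]cA -[X in (_ ^ X)%N]card_ord -card_ffun_on.
  rewrite -sumr_const; apply: ler_sum => a /ffun_onP aA; apply: Gdel.
  apply: le_lt_trans LM.
  apply: rV_norm_le => [|d]; first by rewrite divr_ge0 ?(ltW L0).
  rewrite !mxE.
  have /codomP[j ->] := aA d; rewrite /= natrD natrM.
  have -> : x0 0 d - (x0 0 d - L + (M%:R * k%:R + j%:R) * t) = - (j%:R * t).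
    by rewrite -tL; ring.
  rewrite normrN ger0_norm ?(mulr_ge0 (ler0n _ _) (ltW t0))//.
  have -> : L / M%:R = k%:R * t by rewrite /t; field; rewrite !gt_eqF.
  by rewrite ler_wpM2r ?(ltW t0)// ler_nat ltnW.
have := le_trans lo up; apply/negP; rewrite -ltNge.
have -> : (N ^ n.+1)%:R * (n.+1%:R * eta) = (k ^ n.+1)%:R * (e / 4).
  rewrite /N !natrX natrM exprMn natrM /eta; field.
  by rewrite expf_neq0 ?mulf_neq0 ?gt_eqF// addrC natr1 pnatr_eq0.
by rewrite ltr_pM2l ?ltr0n ?expn_gt0//; lra.
Qed.

(** * Extension by zero *)

Lemma near_eq_continuous_at (T W : topologicalType) (f g : T -> W) x :
  {near x, f =1 g} -> {for x, continuous f} -> {for x, continuous g}.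
Proof.
move=> fg cf; rewrite /prop_for /continuous_at -(nbhs_singleton fg).
by apply: cvg_trans cf; exact: near_eq_cvg.
Qed.

Definition zero_ext (R : realType) (V : normedModType R) (U : set V)
  (f : V -> R) : V -> R := patch (fun=> 0) U f.

Lemma zero_extT (R : realType) (V : normedModType R) (U : set V) (f : V -> R) x :
  U x -> zero_ext U f x = f x.
Proof. by move=> Ux; rewrite /zero_ext patchT// inE. Qed.

Lemma zero_extN (R : realType) (V : normedModType R) (U : set V) (f : V -> R) x :
  ~ U x -> zero_ext U f x = 0.
Proof. by move=> Ux; rewrite /zero_ext patchN// inE /= notin_setE. Qed.

Lemma zero_extM (R : realType) (V : normedModType R) (U : set V) (f g : V -> R)
    x :
  zero_ext U (fun y => f y * g y) x = zero_ext U f x * zero_ext U g x.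
Proof.
have [Ux|Ux] := pselect (U x); first by rewrite !zero_extT.
by rewrite !zero_extN// mulr0.
Qed.

Lemma zero_ext_near (R : realType) (V : normedModType R) (U : set V)
    (f : V -> R) x : open U -> U x -> {near x, f =1 zero_ext U f}.
Proof.
move=> oU Ux; have : \forall y \near x, U y by apply: open_nbhs_nbhs.
by apply: filterS => y Uy; rewrite zero_extT.
Qed.

Lemma zero_ext_continuous_at (R : realType) (V : normedModType R) (U : set V)
    (f : V -> R) x :
  open U -> U x -> {for x, continuous f} -> {for x, continuous (zero_ext U f)}.
Proof.
move=> oU Ux; exact: near_eq_continuous_at (zero_ext_near f oU Ux).
Qed.

Lemma zero_ext_continuous_off (R : realType) (V : normedModType R) (U : set V)
    (f : V -> R) x :
  ~ U x -> (forall e, 0 < e -> \forall y \near x, U y -> `|f y| <= e) ->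
  {for x, continuous (zero_ext U f)}.
Proof.
move=> Ux H; rewrite /prop_for /continuous_at zero_extN//.
apply/cvgrPdist_le => e e0; apply: filterS (H e e0) => y Hy.
rewrite sub0r normrN; have [Uy|Uy] := pselect (U y).
  by rewrite zero_extT//; exact: Hy.
by rewrite zero_extN// normr0 ltW.
Qed.

(* Between [t] and the last zero before [t] the function is differentiable, so
   the mean value theorem applies there. *)
Lemma le_zero_lipschitz (R : realType) (phi : R -> R) (t C : R) :
  0 <= C -> 0 < t -> continuous phi -> phi 0 = 0 ->
  (forall s, 0 <= s <= t -> phi s != 0 ->
     derivable phi s 1 /\ `|'D_1 phi s| <= C) ->
  `|phi t| <= C * t.
Proof.
move=> C0 t0 cphi phi0 dphi.
pose A := `[0, t]%classic `&` phi @^-1` [set 0].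
have [|||c + cmax] := @compact_EVT_max R R id A.
- by exists 0; split => //=; rewrite in_itv /= lexx ltW.
- apply: compact_closedI; first exact: segment_compact.
  by apply: preimage_closed; [move=> x _; exact: cphi|exact: closed_eq].
- by apply: continuous_subspaceT => x; exact: cvg_id.
rewrite inE => -[/=]; rewrite in_itv /= => /andP[c0 ct] pc.
have [->|tc] := eqVneq t c; first by rewrite pc normr0 mulr_ge0.
have {}ct : c < t by rewrite lt_def tc ct.
have nz s : c < s -> s <= t -> derivable phi s 1 /\ `|'D_1 phi s| <= C.
  move=> cs st; apply: dphi; first by rewrite st andbT (le_trans c0)// ltW.
  apply/eqP => ps; have : s <= c.
    by apply: cmax; rewrite inE; split; rewrite //= in_itv /= st (le_trans c0) ?ltW.
  by rewrite leNgt cs.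
have dphi' s : s \in `]c, t[%R -> is_derive s 1 phi ('D_1 phi s).
  by rewrite in_itv /= => /andP[cs st]; apply/derivableP/(nz _ cs _).1/ltW.
have [d] := MVT ct dphi' (continuous_subspaceT cphi).
rewrite in_itv /= pc subr0 => /andP[cd dt] ->; rewrite normrM.
apply: ler_pM => //; first exact: (nz d cd (ltW dt)).2.
by rewrite ger0_norm ?subr_ge0 ?(ltW ct)// lerBlDr lerDl.
Qed.

Lemma zero_ext_derive (R : realType) (V : normedModType R) (U : set V)
    (f : V -> R) (x v : V) :
  open U -> U x -> derivable f x v ->
  is_derive x v (zero_ext U f) ('D_v f x).
Proof.
move=> oU Ux dfx.
by apply: near_eq_is_derive; [exact: zero_ext_near|exact: derivableP].
Qed.

(** A nonzero value of the extension on the ray forces the point to lie in [U], where the derivative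
    is at most [C]. The one-variable estimate from the last zero then applies, as the ray starts at
    a zero. *)
Lemma zero_ext_lipschitz_ray (R : realType) (V : normedModType R) (U : set V)
    (f : V -> R) (x v : V) (C : R) :
  open U -> (forall y, U y -> derivable f y v) ->
  continuous (zero_ext U f) -> ~ U x -> 0 <= C ->
  (\forall y \near x, U y -> `|'D_v f y| <= C) ->
  \forall t \near 0^'+, `|zero_ext U f (x + t *: v)| <= C * t.
Proof.
move=> oU df cf Ux C0 Cx.
have cl : continuous (fun t : R => x + t *: v).
  move=> t; apply: cvgD; first exact: cvg_cst.
  by apply: cvgZ; [exact: cvg_id|exact: cvg_cst].
have : \forall t \near (0 : R), U (x + t *: v) -> `|'D_v f (x + t *: v)| <= C.
  apply: (cl 0 (fun y => U y -> `|'D_v f y| <= C)).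
  by rewrite /= scale0r addr0.
case/nbhs_ballP => r /= r0 Cr.
exists r => // t /=; rewrite sub0r normrN => tr t0; rewrite gtr0_norm// in tr.
apply: (@le_zero_lipschitz R (fun s => zero_ext U f (x + s *: v))) => //.
- by move=> s; exact: (cvg_comp _ _ (cl s) (cf _)).
- by rewrite scale0r addr0 zero_extN.
- move=> s /andP[s0 st] fs.
  have Us : U (x + s *: v).
    by apply: contrapT => /(@zero_extN _ _ _ f) /eqP; apply/negP.
  have [dz E] := zero_ext_derive oU Us (df _ Us).
  have [D1 ->] := derive_line dz.
  split=> //; rewrite E; apply: Cr => //.
  by rewrite -ball_normE /= sub0r normrN ger0_norm// (le_lt_trans st).
Qed.

(* The last two clauses say that [f] tends to 0 at the boundary of [U], while its
   derivative along [v] stays bounded near it. *)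
Definition null_C1 (R : realType) (V : normedModType R) (U : set V) (v : V)
    (f : V -> R) : Prop :=
  [/\ forall x, U x -> differentiable f x,
      forall x, U x -> {for x, continuous ('D_v f)},
      continuous (zero_ext U f)
    & forall x, ~ U x -> exists C, \forall y \near x, U y -> `|'D_v f y| <= C].

(** The one-sided estimates along [v] and [- v] are joined into a two-sided one. *)
Lemma null_C1_lipschitz (R : realType) (V : normedModType R) (U : set V)
    (v : V) (f : V -> R) (x : V) :
  open U -> null_C1 U v f -> ~ U x ->
  exists2 C, 0 <= C &
    \forall t \near (0 : R), `|zero_ext U f (x + t *: v)| <= C * `|t|.
Proof.
move=> oU [df _ cf bf] Ux; have [C0 C0x] := bf _ Ux.
(* The given bound may be negative when [U] has no points near [x]. *)
pose C := `|C0|.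
have Cx : \forall y \near x, U y -> `|'D_v f y| <= C.
  by apply: filterS C0x => y + Uy => /(_ Uy)/le_trans; apply; exact: ler_norm.
have CNx : \forall y \near x, U y -> `|'D_(- v) f y| <= C.
  apply: filterS Cx => y + Uy => /(_ Uy).
  rewrite !deriveE; [|exact: df|exact: df].
  by rewrite linearN normrN.
exists C; first exact: normr_ge0.
have Df w y : U y -> derivable f y w by move=> Uy; exact/diff_derivable/df.
have := zero_ext_lipschitz_ray oU (Df v) cf Ux (normr_ge0 _) Cx.
have := zero_ext_lipschitz_ray oU (Df (- v)) cf Ux (normr_ge0 _) CNx.
case=> r1 /= r10 H1 [r2 /= r20 H2].
apply: (@filterS _ _ _ (ball (0 : R) (Num.min r1 r2))); last first.
  by apply: nbhsx_ballx; rewrite lt_min r10.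
move=> t; rewrite -ball_normE /= sub0r normrN lt_min => /andP[t1 t2].
have [t0|t0|->] := ltgtP t 0.
- rewrite -[t in zero_ext _ _ (_ + t *: _)]opprK scaleNr -scalerN.
  by rewrite [`|t|]ltr0_norm//; apply: H1; rewrite ?oppr_gt0//= sub0r opprK.
- by rewrite [`|t|]gtr0_norm//; apply: H2; rewrite //= sub0r normrN.
- by rewrite scale0r addr0 zero_extN// normr0 mulr0.
Qed.

(** Off [U] both extended factors are O(t) along [v], so their product is O(t^2) and has derivative
    0. The product rule expression tends to 0 there, each term being a bounded derivative times a
    factor that vanishes. *)
Lemma null_C1_mul (R : realType) (V : normedModType R) (U : set V)
    (v : V) (f g : V -> R) :
  open U -> null_C1 U v f -> null_C1 U v g ->
  let h := zero_ext U (fun x => 'D_v f x * g x + f x * 'D_v g x) in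
  (forall x, is_derive x v (zero_ext U (fun x => f x * g x)) (h x)) /\
  continuous h.
Proof.
move=> oU nf ng h; have [df cf zf bf] := nf; have [dg cg zg bg] := ng.
split=> x; have [Ux|Ux] := pselect (U x).
- rewrite /h zero_extT//.
  have D : is_derive x v (fun x => f x * g x) ('D_v f x * g x + f x * 'D_v g x).
    have /derivableP Df := diff_derivable (v := v) (df x Ux).
    have /derivableP Dg := diff_derivable (v := v) (dg x Ux).
    by apply: is_derive_eq; rewrite addrC; congr (_ + _); exact: mulrC.
  have [D1 D2] := D; rewrite -D2; exact: zero_ext_derive.
- have [C C0 Cf] := null_C1_lipschitz oU nf Ux.
  have [K K0 Kg] := null_C1_lipschitz oU ng Ux.
  rewrite /h zero_extN//.
  set fg := zero_ext U (fun x => f x * g x).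
  (* The difference quotient is dominated by [C * K * |t|]. *)
  have E : (fun t : R => t^-1 *: ((fg \o shift x) (t *: v) - fg x)) @ 0^' -->
      (0 : R).
    rewrite [fg x]zero_extN//; apply: norm_cvg0.
    apply: (@squeeze_cvgr _ _ _ _ (cst 0) (fun t => C * K * `|t|)).
    + near=> t; rewrite normr_ge0 /= subr0.
      have t0 : 0 < `|t| by rewrite normr_gt0; near: t; exact: nbhs_dnbhs_neq.
      rewrite normrM normfV ler_pdivrMl//.
      rewrite [t *: v + x]addrC /fg zero_extM normrM mulrCA -expr2.
      rewrite (_ : _ * _ ^+ 2 = (C * `|t|) * (K * `|t|)); last by ring.
      apply: ler_pM => //; near: t; exact: nbhs_dnbhs.
    + exact: cvg_cst.
    + rewrite -[X in _ --> X](_ : C * K * `|0 : R| = 0); last first.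
        by rewrite normr0 mulr0.
      by apply: cvgM; [exact: cvg_cst|apply: cvg_norm; exact: nbhs_dnbhs].
  apply: DeriveDef; first by apply/cvg_ex; exists 0.
  exact/cvg_lim.
- apply: zero_ext_continuous_at => //.
  have fx := differentiable_continuous (df x Ux).
  have gx := differentiable_continuous (dg x Ux).
  exact: (continuousD (continuousM (cf x Ux) gx) (continuousM fx (cg x Ux))).
- have [C Cf] := bf x Ux; have [K Kg] := bg x Ux.
  rewrite /prop_for /continuous_at {2}/h zero_extN//; apply: norm_cvg0.
  apply: (@squeeze_cvgr _ _ _ _ (cst 0)
    (fun y => C * `|zero_ext U g y| + K * `|zero_ext U f y|)).
  + near=> y; rewrite normr_ge0 /= /h.
    have Hf : U y -> `|'D_v f y| <= C by near: y.
    have Hg : U y -> `|'D_v g y| <= K by near: y.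
    have [Uy|Uy] := pselect (U y); last by rewrite !zero_extN// normr0 !mulr0 addr0.
    rewrite !zero_extT//; apply: le_trans (ler_normD _ _) _; rewrite !normrM.
    by rewrite [X in _ + X <= _]mulrC lerD// ler_wpM2r//; [exact: Hf|exact: Hg].
  + exact: cvg_cst.
  + have -> : (0 : R) = C * `|zero_ext U g x| + K * `|zero_ext U f x|.
      by rewrite !zero_extN// normr0 !mulr0 addr0.
    by apply: cvgD; (apply: cvgM; first exact: cvg_cst); apply: cvg_norm;
        [exact: zg|exact: zf].
Unshelve. all: by end_near. Qed.

(** * Linearity of curl and divergence *)

Lemma points_open (R : realType) (D : domain R) : open (points D).
Proof. by case: D => //=; exact: openT. Qed.

Lemma points_near (R : realType) (D : domain R) (T : Type)
    (f g : 'rV[R]_3 -> T) x :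
  (forall y, points D y -> f y = g y) -> points D x -> {near x, f =1 g}.
Proof.
move=> fg Dx; have : \forall y \near x, points D y.
  by apply: open_nbhs_nbhs; split => //; exact: points_open.
by apply: filterS => y /fg.
Qed.

(** The difference [g \- f] vanishes near [x], so it is differentiable there with differential 0;
    adding it to [f] gives [g]. *)
Lemma near_eq_differentiable (R : realType) (V W : normedModType R)
    (f g : V -> W) x :
  {near x, f =1 g} -> differentiable f x -> differentiable g x.
Proof.
move=> fg df.
have dz : differentiable (g \- f) x.
  have fg0 : \forall h \near (0 : V), f (h + x) = g (h + x).
    have ch : (h + x) @[h --> (0 : V)] --> x.
      by rewrite -[X in _ --> X]add0r; apply: cvgD; [exact: cvg_id|exact: cvg_cst].
    exact: (ch (fun y => f y = g y) fg).
  have E : (g \- f) \o shift x = cst ((g \- f) x) + \0 +o_ (0 : V) id.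
    apply/eqaddoP => e e0; near=> h.
    rewrite /= !fctE /= /cst /= (nbhs_singleton fg) !subrr addr0.
    rewrite (near fg0)//.
    by rewrite !subrr normr0 mulr_ge0 // ltW.
  have c0 : continuous (\0 : V -> W) by move=> y; exact: cvg_cst.
  by apply/diff_locallyP; rewrite (diff_unique c0 E).
have -> : g = f + (g \- f) by apply/funext => y /=; rewrite !fctE addrC subrK.
exact: differentiableD.
Unshelve. all: by end_near. Qed.

Lemma C1_eq (R : realType) (V : normedModType R) (D : domain R)
    (f g : 'rV[R]_3 -> V) :
  (forall x, points D x -> f x = g x) -> C1 D f -> C1 D g.
Proof.
move=> fg [pf df]; split.
  case: D fg pf {df} => //= fg pf i x.
  by rewrite -!fg// pf.
move=> x Dx; have [dfx cfx] := df x Dx.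
have fgx := points_near fg Dx; split; first exact: near_eq_differentiable fgx dfx.
move=> i; have E y : points D y -> 'D_(basis3 i) f y = 'D_(basis3 i) g y.
  by move=> Dy; apply: near_eq_derive; exact: (points_near fg Dy).
exact: near_eq_continuous_at (points_near E Dx) (cfx i).
Qed.

Lemma C1_comb (R : realType) (V : normedModType R) (D : domain R) (a b : R)
    (u w : 'rV[R]_3 -> V) :
  C1 D u -> C1 D w -> C1 D (fun x => a *: u x + b *: w x).
Proof.
move=> [pu du] [pw dw]; split.
  by case: D pu pw {du dw} => //= pu pw i x; rewrite pu pw.
move=> x Dx; have [dux cux] := du x Dx; have [dwx cwx] := dw x Dx.
split; first by apply: differentiableD; exact: differentiableZ.
move=> i; have E y : points D y -> a *: 'D_(basis3 i) u y + b *: 'D_(basis3 i) w y =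
    'D_(basis3 i) (fun x => a *: u x + b *: w x) y.
  move=> Dy; have Du := diff_derivable (v := basis3 i) (du y Dy).1.
  have Dw := diff_derivable (v := basis3 i) (dw y Dy).1.
  by rewrite deriveD; [rewrite !deriveZ|exact: derivableZ|exact: derivableZ].
apply: near_eq_continuous_at (points_near E Dx) _.
by apply: continuousD; (apply: continuousZ; first exact: cst_continuous).
Qed.

Lemma partial_derive (R : realType) (i j : 'I_3) (u : 'rV[R]_3 -> 'rV[R]_3) x :
  differentiable u x -> partial i j u x = 'D_(basis3 i) u x 0 j.
Proof. by move=> du; rewrite derive_mx ?mxE//; exact: diff_derivable. Qed.

Lemma partial_eq (R : realType) (D : domain R)
    (u w : 'rV[R]_3 -> 'rV[R]_3) i j x : (forall y, points D y -> u y = w y) ->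
  points D x -> partial i j u x = partial i j w x.
Proof.
move=> uw Dx; apply: near_eq_derive.
by apply: filterS (points_near uw Dx) => y ->.
Qed.

Lemma curl_eq (R : realType) (D : domain R)
    (u w : 'rV[R]_3 -> 'rV[R]_3) x : (forall y, points D y -> u y = w y) ->
  points D x -> curl u x = curl w x.
Proof.
move=> uw Dx; apply/rowP => i; rewrite !mxE.
by rewrite !(partial_eq _ _ uw Dx).
Qed.

Lemma divergence_eq (R : realType) (D : domain R)
    (u w : 'rV[R]_3 -> 'rV[R]_3) x : (forall y, points D y -> u y = w y) ->
  points D x -> divergence u x = divergence w x.
Proof. by move=> uw Dx; apply: eq_bigr => i _; exact: (partial_eq _ _ uw Dx). Qed.

Lemma partial_comb (R : realType) (D : domain R) (a b : R)
    (u w : 'rV[R]_3 -> 'rV[R]_3) i j x : C1 D u -> C1 D w -> points D x ->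
  partial i j (fun x => a *: u x + b *: w x) x =
  a * partial i j u x + b * partial i j w x.
Proof.
move=> [_ du] [_ dw] Dx; have [dux _] := du x Dx; have [dwx _] := dw x Dx.
rewrite !partial_derive//; last by apply: differentiableD; exact: differentiableZ.
have Du := diff_derivable (v := basis3 i) dux.
have Dw := diff_derivable (v := basis3 i) dwx.
rewrite deriveD; [|exact: derivableZ|exact: derivableZ].
by rewrite !deriveZ// !mxE.
Qed.

Lemma curl_comb (R : realType) (D : domain R) (a b : R)
    (u w : 'rV[R]_3 -> 'rV[R]_3) x : C1 D u -> C1 D w -> points D x ->
  curl (fun x => a *: u x + b *: w x) x = a *: curl u x + b *: curl w x.
Proof.
move=> cu cw Dx; apply/rowP => i; rewrite !mxE !(partial_comb _ _ _ _ cu cw Dx).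
by ring.
Qed.

Lemma divergence_comb (R : realType) (D : domain R) (a b : R)
    (u w : 'rV[R]_3 -> 'rV[R]_3) x : C1 D u -> C1 D w -> points D x ->
  divergence (fun x => a *: u x + b *: w x) x =
  a * divergence u x + b * divergence w x.
Proof.
move=> cu cw Dx; rewrite /divergence !big_distrr -big_split /=.
by apply: eq_bigr => i _; exact: (partial_comb _ _ _ _ cu cw Dx).
Qed.

(** * The divergence of a cross product *)

Lemma ord3E :
  ((0 + 1 = 1 :> 'I_3)%R * (0 + 2%:R = 2%:R :> 'I_3)%R *
   (1 + 1 = 2%:R :> 'I_3)%R * (1 + 2%:R = 0 :> 'I_3)%R *
   (2%:R + 1 = 0 :> 'I_3)%R * (2%:R + 2%:R = 1 :> 'I_3)%R)%type.
Proof. by do !split; apply: val_inj. Qed.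

Lemma sum_ord3 (V : nmodType) (f : 'I_3 -> V) :
  \sum_i f i = f 0 + f 1 + f 2%:R.
Proof.
rewrite !big_ord_recl big_ord0 addr0 addrA.
by congr (f _ + f _ + f _); apply: val_inj.
Qed.

(** The identity div (u x w) = w . curl u - u . curl w after the product rule, as pure algebra:
    [P i j] and [Q i j] stand for the derivatives in direction [i] of the [j]-th components of u and
    w. *)
Lemma divergence_cross (R : comNzRingType) (P Q : 'I_3 -> 'I_3 -> R)
    (u w : 'I_3 -> R) :
  \sum_i (P i (i + 1) * w (i + 2%:R) + u (i + 1) * Q i (i + 2%:R)
          - (P i (i + 2%:R) * w (i + 1) + u (i + 2%:R) * Q i (i + 1))) =
  \sum_i (w i * (P (i + 1) (i + 2%:R) - P (i + 2%:R) (i + 1))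
          - u i * (Q (i + 1) (i + 2%:R) - Q (i + 2%:R) (i + 1))).
Proof. by rewrite !sum_ord3 !ord3E; ring. Qed.

(** A common form of the torus and the bounded case: the cross product, extended by 0, takes equal
    values on opposite faces of a box around [x0] and has a nonnegative divergence. *)
Lemma cross_divergence_eq0 (R : realType) (U : set 'rV[R]_3)
    (u w : 'rV[R]_3 -> 'rV[R]_3) (x0 : 'rV[R]_3) (L : R) :
  open U -> 0 < L ->
  (forall i j, null_C1 U (basis3 i) (fun x => u x 0 j)) ->
  (forall i j, null_C1 U (basis3 i) (fun x => w x 0 j)) ->
  (forall i j (x : 'rV[R]_3), x 0 i = x0 0 i - L ->
     zero_ext U (fun y => u y 0 j) (x + (2 * L) *: basis3 i) =
     zero_ext U (fun y => u y 0 j) x) ->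
  (forall i j (x : 'rV[R]_3), x 0 i = x0 0 i - L ->
     zero_ext U (fun y => w y 0 j) (x + (2 * L) *: basis3 i) =
     zero_ext U (fun y => w y 0 j) x) ->
  let g x := \sum_i (w x 0 i * curl u x 0 i - u x 0 i * curl w x 0 i) in
  (forall x, U x -> 0 <= g x) -> U x0 -> g x0 = 0.
Proof.
move=> oU L0 nu nw pu pw g g0 Ux0.
(* [F] is the cross product of [u] and [w] extended by 0, and [G i] is the derivative of its [i]-th
   component in direction [i]. *)
pose F (i : 'I_3) (x : 'rV[R]_3) :=
  zero_ext U (fun x => u x 0 (i + 1) * w x 0 (i + 2%:R)) x -
  zero_ext U (fun x => u x 0 (i + 2%:R) * w x 0 (i + 1)) x.
pose G (i : 'I_3) (x : 'rV[R]_3) :=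
  zero_ext U (fun x => partial i (i + 1) u x * w x 0 (i + 2%:R) +
                       u x 0 (i + 1) * partial i (i + 2%:R) w x) x -
  zero_ext U (fun x => partial i (i + 2%:R) u x * w x 0 (i + 1) +
                       u x 0 (i + 2%:R) * partial i (i + 1) w x) x.
have dF i x : is_derive x (basis3 i) (F i) (G i x).
  apply: is_deriveB.
    by have [+ _] := null_C1_mul oU (nu i (i + 1)) (nw i (i + 2%:R)); exact.
  by have [+ _] := null_C1_mul oU (nu i (i + 2%:R)) (nw i (i + 1)); exact.
have DF i x : 'D_(basis3 i) (F i) x = G i x by have [] := dF i x.
have sG x : \sum_i G i x = zero_ext U g x.
  have [Ux|Ux] := pselect (U x); last first.
    by rewrite zero_extN// big1// => i _; rewrite /G !zero_extN// subrr.
  rewrite zero_extT// /g /G.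
  under eq_bigr do rewrite !zero_extT//.
  rewrite (divergence_cross (fun i j => partial i j u x)
    (fun i j => partial i j w x) (fun i => u x 0 i) (fun i => w x 0 i)).
  by apply: eq_bigr => i _; rewrite !mxE.
rewrite -(zero_extT g Ux0) -sG.
under eq_bigr do rewrite -DF.
apply: (@periodic_nonneg_divergence_eq0 R 2 F x0 L) => //.
- move=> i x.
  have -> : 'D_(delta_mx 0 i) (F i) = G i by apply/funext => y; exact: DF.
  apply: continuousB.
    by have [_ +] := null_C1_mul oU (nu i (i + 1)) (nw i (i + 2%:R)); exact.
  by have [_ +] := null_C1_mul oU (nu i (i + 2%:R)) (nw i (i + 1)); exact.
- by move=> i x xi; rewrite /F !zero_extM !pu// !pw.
- move=> x; under eq_bigr do rewrite DF.
  rewrite sG; have [Ux|Ux] := pselect (U x); last by rewrite zero_extN.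
  by rewrite zero_extT//; exact: g0.
Qed.

(** * Regularity and periodicity on the torus and on bounded domains *)

Lemma C1_component (R : realType) (D : domain R) (u : 'rV[R]_3 -> 'rV[R]_3)
    (i j : 'I_3) x : C1 D u -> points D x ->
  differentiable (fun y => u y 0 j) x /\
  {for x, continuous ('D_(basis3 i) (fun y => u y 0 j))}.
Proof.
move=> [_ du] Dx; have [dux cux] := du x Dx; split.
  exact: (differentiable_comp dux (differentiable_coord (u x) 0 j)).
have E y : points D y -> 'D_(basis3 i) u y 0 j = 'D_(basis3 i) (fun y => u y 0 j) y.
  by move=> Dy; rewrite -partial_derive//; exact: (du y Dy).1.
apply: near_eq_continuous_at (points_near E Dx) _.
exact: (cvg_comp _ _ (cux i) (@coord_continuous R 1 3 0 j _)).
Qed.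

(** With [U] the whole space the boundary clauses are vacuous, and the zero extension is the
    function itself. *)
Lemma torus_null_C1 (R : realType) (u : 'rV[R]_3 -> 'rV[R]_3) (i j : 'I_3) :
  C1 Torus u -> null_C1 setT (basis3 i) (fun x => u x 0 j).
Proof.
move=> cu; split=> // x; first by move=> _; exact: (C1_component i j cu I).1.
- by move=> _; exact: (C1_component i j cu I).2.
- apply: zero_ext_continuous_at => //; first exact: openT.
  exact/differentiable_continuous/(C1_component i j cu I).1.
- by case.
Qed.

Lemma near_notin_closure (T : topologicalType) (U : set T) x :
  ~ closure U x -> \forall y \near x, ~ U y.
Proof.
move=> Ux; have : \forall y \near x, (~` closure U) y.
  apply: open_nbhs_nbhs; split => //; apply: closed_openC; exact: closed_closure.
by apply: filterS => y; apply: contra_not; exact: subset_closure.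
Qed.

Lemma within_closure_near (R : realType) (V W : normedModType R) (U : set V)
    (g : V -> W) x (e : R) :
  {within closure U, continuous g} -> closure U x -> 0 < e ->
  \forall y \near x, U y -> `|g x - g y| <= e.
Proof.
move=> cg Ux e0.
have /subspace_continuousP/(_ x Ux)/cvgrPdist_le/(_ e e0) := cg.
by rewrite near_withinE; apply: filterS => y + Uy; apply; exact: subset_closure.
Qed.

Lemma le_norm_entry (R : realType) (n : nat) (v : 'rV[R]_n) i : `|v 0 i| <= `|v|.
Proof.
rewrite [leRHS]/Num.Def.normr/= mx_normrE.
exact: (le_bigmax _ (fun ij => `|v ij.1 ij.2|) (ord0, i)).
Qed.

(** A point off [U] is either away from the closure, where nothing is to be shown, or on the
    boundary. There continuity up to the boundary makes the field small and bounds its derivatives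
    by those of the extension [g]. *)
Lemma zero_boundary_null_C1 (R : realType) (U : set 'rV[R]_3) (oU : open U)
    (u : 'rV[R]_3 -> 'rV[R]_3) (i j : 'I_3) :
  C1 (OpenSet U oU) u -> zero_boundary U u ->
  null_C1 U (basis3 i) (fun x => u x 0 j).
Proof.
move=> cu [[cl dl] u0]; split.
- by move=> x Ux; exact: (C1_component i j cu Ux).1.
- by move=> x Ux; exact: (C1_component i j cu Ux).2.
- move=> x; have [Ux|Ux] := pselect (U x).
    apply: zero_ext_continuous_at => //.
    exact/differentiable_continuous/(C1_component i j cu Ux).1.
  apply: zero_ext_continuous_off => // e e0.
  have [cx|cx] := pselect (closure U x); last first.
    by apply: filterS (near_notin_closure cx) => y.
  apply: filterS (within_closure_near cl cx e0) => y + Uy => /(_ Uy).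
  rewrite u0// sub0r normrN; exact/le_trans/le_norm_entry.
- move=> x Ux; have [cx|cx] := pselect (closure U x); last first.
    by exists 0; apply: filterS (near_notin_closure cx) => y.
  have [g cg ug] := dl i; exists (`|g x| + 1).
  apply: filterS (within_closure_near cg cx ltr01) => y + Uy => /(_ Uy) H.
  rewrite -/(partial i j u y) partial_derive; last by have [_ /(_ _ Uy)[]] := cu.
  rewrite ug// (le_trans (le_norm_entry _ _))// -[g y](subKr (g x)).
  by rewrite (le_trans (ler_normB _ _))// lerD2l.
Qed.

Lemma bounded_zero_ext_periodic (R : realType) (U : set 'rV[R]_3)
    (x0 : 'rV[R]_3) : bounded_set U ->
  exists2 L, 0 < L & forall (f : 'rV[R]_3 -> R) i (x : 'rV[R]_3),
    x 0 i = x0 0 i - L ->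
    zero_ext U f (x + (2 * L) *: basis3 i) = zero_ext U f x.
Proof.
move=> [M [_ HM]]; pose r := `|M| + 1.
have Ur x : U x -> `|x| <= r.
  by apply: HM; rewrite /r (le_lt_trans (ler_norm M))// ltrDl.
have r0 : 0 < r by rewrite /r ltr_wpDl.
have far (y : 'rV[R]_3) i : r < `|y 0 i| -> ~ U y.
  by move=> ry /Ur; rewrite leNgt (lt_le_trans ry)// le_norm_entry.
(* On the two faces the [i]-th coordinate is that of [x0] plus or minus [L], which exceeds [r] in
   absolute value; both points lie outside [U] and both values are 0. *)
exists (`|x0| + r + 1) => [|f i x xi]; first by rewrite ltr_wpDl// addr_ge0// ltW.
have := le_norm_entry x0 i; rewrite ler_norml => /andP[x1 x2].
rewrite !zero_extN//; apply: (far _ i).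
  by rewrite xi ltr_normr; apply/orP; right; lra.
rewrite !mxE xi eqxx /= ltr_normr; apply/orP; left.
by rewrite eqxx mulr1; lra.
Qed.

Lemma torus_zero_ext_periodic (R : realType) (u : 'rV[R]_3 -> 'rV[R]_3) i j
    (x : 'rV[R]_3) : C1 Torus u ->
  zero_ext setT (fun y => u y 0 j) (x + (2 * pi) *: basis3 i) =
  zero_ext setT (fun y => u y 0 j) x.
Proof. by move=> [pu _]; rewrite !zero_extT// pu. Qed.

Lemma nonneg_cross_divergence_eq0 (R : realType) (D : domain R)
    (u w : 'rV[R]_3 -> 'rV[R]_3) :
  C1 D u -> C1 D w -> torus_or_zero_boundary D u w ->
  let g x := \sum_i (w x 0 i * curl u x 0 i - u x 0 i * curl w x 0 i) in
  (forall x, points D x -> 0 <= g x) -> forall x, points D x -> g x = 0.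
Proof.
case: D => [U oU|] cu cw /= H.
  case: H => bU zu zw g0 x Ux.
  have [L L0 per] := bounded_zero_ext_periodic x bU.
  apply: (cross_divergence_eq0 oU L0) => // i j.
  - exact: zero_boundary_null_C1 cu zu.
  - exact: zero_boundary_null_C1 cw zw.
  - by move=> y; exact: per.
  - by move=> y; exact: per.
move=> g0 x _.
(* A box of half-side [pi] is exactly one period. *)
apply: (cross_divergence_eq0 openT (pi_gt0 R)) => // i j.
- exact: torus_null_C1.
- exact: torus_null_C1.
- by move=> y _; exact: torus_zero_ext_periodic.
- by move=> y _; exact: torus_zero_ext_periodic.
Qed.

(** * Linear algebra of Beltrami and double Beltrami fields *)

Lemma beltrami_scale (R : realType) (D : domain R) (k : R)
    (lambda : 'rV[R]_3 -> R) (u : 'rV[R]_3 -> 'rV[R]_3) :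
  beltrami D lambda u -> beltrami D lambda (fun x => k *: u x).
Proof.
move=> [cu bu].
(* A zero term is added so that the lemmas on two-term combinations apply. *)
have E y : points D y -> k *: u y + 0 *: u y = k *: u y.
  by move=> _; rewrite scale0r addr0.
split; first exact: C1_eq E (C1_comb k 0 cu cu).
move=> x Dx; have [c0 d0] := bu x Dx.
rewrite -(curl_eq E Dx) -(divergence_eq E Dx).
rewrite (curl_comb _ _ cu cu Dx) (divergence_comb _ _ cu cu Dx) c0 d0.
by rewrite !mulr0 addr0 scale0r addr0 !scalerA mulrC.
Qed.

(** The equations give curl (a u + b B) = (a alpha + b) u + (b beta - a) B; the last hypothesis says
    that [(a, b)] is an eigenvector of this action with eigenvalue [lambda]. *)
Lemma beltrami_comb (R : realType) (D : domain R) (a b : R)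
    (alpha beta lambda : 'rV[R]_3 -> R) (u B : 'rV[R]_3 -> 'rV[R]_3) :
  C1 D u -> C1 D B ->
  (forall x, points D x -> divergence u x = 0 /\ divergence B x = 0) ->
  (forall x, points D x -> B x + curl u x = alpha x *: u x /\
     u x - curl B x = - (beta x *: B x)) ->
  (forall x, points D x -> a * alpha x + b = lambda x * a /\
     b * beta x - a = lambda x * b) ->
  beltrami D lambda (fun x => a *: u x + b *: B x).
Proof.
move=> cu cB dv ab l; split; first exact: C1_comb.
move=> x Dx; have [du dB] := dv x Dx; have [E1 E2] := ab x Dx.
have [l1 l2] := l x Dx.
rewrite (curl_comb _ _ cu cB Dx) (divergence_comb _ _ cu cB Dx) du dB.
rewrite !mulr0 addr0; split=> //.
have -> : curl u x = alpha x *: u x - B x by rewrite -E1 addrC addKr.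
have -> : curl B x = u x + beta x *: B x by rewrite -[beta x *: _]opprK -E2 subKr.
apply/rowP => i; rewrite !mxE [RHS]mulrDr [X in _ = X + _]mulrA.
by rewrite [X in _ = _ + X]mulrA -l1 -l2; ring.
Qed.

(** If u = a + b, then alpha - lambda1 = p and alpha - lambda2 = q give B = p a + q b. If B = a + b,
    the same computation with [beta] gives u = q a + p b. The remaining equation is compared
    coefficientwise and uses p q = 1. *)
Lemma superposition_double_beltrami (R : realType) (D : domain R) (p q : R)
    (alpha beta lambda1 lambda2 : 'rV[R]_3 -> R) :
  p * q = 1 ->
  (forall x, points D x ->
     [/\ alpha x = lambda1 x + p, alpha x = lambda2 x + q,
         beta x = lambda1 x - q & beta x = lambda2 x - p]) ->
  (forall u, sumset D (beltrami D lambda1) (beltrami D lambda2) u ->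
     double_beltrami_eqs D alpha beta u (fun x => - curl u x + alpha x *: u x)) /\
  (forall B, sumset D (beltrami D lambda1) (beltrami D lambda2) B ->
     double_beltrami_eqs D alpha beta (fun x => curl B x - beta x *: B x) B).
Proof.
move=> pq ab.
have main v : sumset D (beltrami D lambda1) (beltrami D lambda2) v ->
    exists a b, [/\ C1 D a, C1 D b, C1 D v,
      forall x, points D x -> v x = a x + b x /\
        curl v x = lambda1 x *: a x + lambda2 x *: b x &
      forall k l x, points D x -> curl (fun x => k *: a x + l *: b x) x =
        (k * lambda1 x) *: a x + (l * lambda2 x) *: b x].
  move=> [a [b [[ca Ba] [cb Bb] vab]]]; exists a, b.
  have cl k l x : points D x -> curl (fun x => k *: a x + l *: b x) x =
        (k * lambda1 x) *: a x + (l * lambda2 x) *: b x.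
    move=> Dx; rewrite (curl_comb _ _ ca cb Dx) (Ba x Dx).1 (Bb x Dx).1.
    by rewrite !scalerA.
  have E y : points D y -> 1 *: a y + 1 *: b y = v y.
    by move=> Dy; rewrite !scale1r vab.
  split; [exact: ca|exact: cb|exact: C1_eq E (C1_comb 1 1 ca cb)| |exact: cl].
  by move=> x Dx; rewrite -(curl_eq E Dx) cl// !mul1r vab.
split=> v /main[a [b [ca cb cv vab cl]]].
- have E y : points D y -> p *: a y + q *: b y = - curl v y + alpha y *: v y.
    move=> Dy; have [a1 a2 _ _] := ab y Dy.
    have [-> ->] := vab y Dy; rewrite scalerDr {1}a1 a2.
    by apply/rowP => i; rewrite !mxE; ring.
  split; [exact: cv|exact: C1_eq E (C1_comb p q ca cb)|].
  move=> x Dx; split; first by rewrite addrAC addNr add0r.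
  rewrite -(curl_eq E Dx) -E// cl// (vab x Dx).1.
  have [_ _ b1 b2] := ab x Dx.
  (* [beta] is read as [lambda1 - q] on the first summand and [lambda2 - p] on the second; the
     coefficient 1 of [u] is then written as [p * q]. *)
  rewrite scalerDr {1}b1 b2; apply/rowP => i; rewrite !mxE.
  rewrite -[X in X + _ - _]mul1r -[X in _ + X - _]mul1r -pq; ring.
- have E y : points D y -> q *: a y + p *: b y = curl v y - beta y *: v y.
    move=> Dy; have [_ _ b1 b2] := ab y Dy.
    have [-> ->] := vab y Dy; rewrite scalerDr {1}b1 b2.
    by apply/rowP => i; rewrite !mxE; ring.
  split; [exact: C1_eq E (C1_comb q p ca cb)|exact: cv|].
  move=> x Dx; split; last by rewrite addrAC subrr add0r.
  rewrite -(curl_eq E Dx) -E// cl// (vab x Dx).1.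
  have [a1 a2 _ _] := ab x Dx.
  rewrite scalerDr {1}a1 a2; apply/rowP => i; rewrite !mxE.
  rewrite -[X in X + _ + _]mul1r -[X in _ + X + _]mul1r -pq; ring.
Qed.

(** The system u = a + b, B = p a + q b is solved for a and b, which is possible as p and q differ;
    each solution is an eigencombination of [u] and [B]. *)
Lemma double_beltrami_superposition (R : realType) (D : domain R) (p q : R)
    (alpha beta lambda1 lambda2 : 'rV[R]_3 -> R) u B :
  p * q = 1 -> p != q ->
  (forall x, points D x ->
     [/\ lambda1 x = alpha x - p, lambda2 x = alpha x - q,
         lambda1 x = beta x + q & lambda2 x = beta x + p]) ->
  double_beltrami_state D alpha beta u B ->
  sumset D (beltrami D lambda1) (beltrami D lambda2) u /\
  sumset D (beltrami D lambda1) (beltrami D lambda2) B.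
Proof.
move=> pq npq l [_ _ dv [cu cB eqs]].
have d0 : q - p != 0 by rewrite subr_eq0 eq_sym.
pose s := (q - p)^-1; have sE : s * (q - p) = 1 by rewrite mulVf.
have b1 : beltrami D lambda1 (fun x => (q * s) *: u x + (- s) *: B x).
  apply: beltrami_comb dv eqs _ => // x Dx; have [l1 _ l3 _] := l x Dx.
  split; last by rewrite l3; ring.
  have -> : lambda1 x * (q * s) = q * s * alpha x - p * q * s by rewrite l1; ring.
  by rewrite pq; ring.
have b2 : beltrami D lambda2 (fun x => (- p * s) *: u x + s *: B x).
  apply: beltrami_comb dv eqs _ => // x Dx; have [_ l2 _ l4] := l x Dx.
  split; last by rewrite l4; ring.
  have -> : lambda2 x * (- p * s) = - p * s * alpha x + p * q * s.
    by rewrite l2; ring.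
  by rewrite pq; ring.
split.
- exists (fun x => (q * s) *: u x + (- s) *: B x),
         (fun x => (- p * s) *: u x + s *: B x); split=> // x _.
  apply/rowP => i; rewrite !mxE -[LHS]mul1r -sE; ring.
- exists (fun x => p *: ((q * s) *: u x + (- s) *: B x)),
         (fun x => q *: ((- p * s) *: u x + s *: B x)).
  split; [exact: beltrami_scale|exact: beltrami_scale|move=> x _].
  apply/rowP => i; rewrite !mxE -[LHS]mul1r -sE; ring.
Qed.

Lemma double_beltrami_critical (R : realType) (D : domain R) (p : R)
    (alpha beta lambda : 'rV[R]_3 -> R) u B :
  p * p = 1 ->
  (forall x, points D x -> lambda x = alpha x - p /\ lambda x = beta x + p) ->
  torus_or_zero_boundary D u B -> double_beltrami_state D alpha beta u B ->
  beltrami D lambda u /\ beltrami D lambda B.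
Proof.
move=> pp l bd [_ _ dv [cu cB eqs]].
have cuE x : points D x -> curl u x = alpha x *: u x - B x.
  by move=> Dx; have [<- _] := eqs x Dx; rewrite addrC addKr.
have cBE x : points D x -> curl B x = u x + beta x *: B x.
  by move=> Dx; have [_ E] := eqs x Dx; rewrite -[beta x *: _]opprK -E subKr.
have sq x : points D x ->
    \sum_i (u x 0 i * curl B x 0 i - B x 0 i * curl u x 0 i) =
    \sum_i (p * u x 0 i - B x 0 i) ^+ 2.
  move=> Dx; apply: eq_bigr => i _; rewrite cuE// cBE// !mxE.
  have [l1 l2] := l x Dx.
  have -> : alpha x = beta x + p + p by rewrite -l2 l1; ring.
  have -> : (p * u x 0 i - B x 0 i) ^+ 2 = p * p * u x 0 i ^+ 2
      - (p + p) * u x 0 i * B x 0 i + B x 0 i ^+ 2 by ring.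
  by rewrite pp; ring.
(* The field with nonnegative divergence is B x u, so the two fields enter in swapped order. *)
have bd' : torus_or_zero_boundary D B u.
  by case: D bd {l dv cu cB eqs cuE cBE sq} => // U oU [].
have ge0 x : points D x ->
    0 <= \sum_i (u x 0 i * curl B x 0 i - B x 0 i * curl u x 0 i).
  by move=> Dx; rewrite sq// sumr_ge0// => i _; exact: sqr_ge0.
have BE x : points D x -> B x = p *: u x.
  move=> Dx; have /eqP := nonneg_cross_divergence_eq0 cB cu bd' ge0 Dx.
  rewrite sq// psumr_eq0; last by move=> i _; exact: sqr_ge0.
  (* A vanishing sum of squares forces each component of [p *: u x - B x] to be 0. *)
  move=> /allP H; apply/rowP => i; rewrite mxE.
  have := H i (mem_index_enum _); rewrite sqrf_eq0 subr_eq0 => /eqP ->.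
  by [].
split; split=> // x Dx; have [du dB] := dv x Dx; have [l1 l2] := l x Dx.
- by rewrite du cuE// BE// l1 scalerBl.
- have uE : u x = p *: B x by rewrite BE// scalerA pp scale1r.
  by rewrite dB cBE// uE l2 scalerDl addrC.
Qed.

Theorem theorem2p1 (R : realType) (D : domain R) :
  (forall lambda1 lambda2 : 'rV[R]_3 -> R,
     C1 D lambda1 -> C1 D lambda2 ->
     constant_on D (fun x => lambda1 x - lambda2 x) ->
     let alpha := fun x =>
       (lambda1 x + lambda2 x + Num.sqrt ((lambda1 x - lambda2 x) ^+ 2 + 4)) / 2 in
     let beta := fun x =>
       (lambda1 x + lambda2 x - Num.sqrt ((lambda1 x - lambda2 x) ^+ 2 + 4)) / 2 in
     (forall u, sumset D (beltrami D lambda1) (beltrami D lambda2) u ->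
        double_beltrami_eqs D alpha beta
          u (fun x => - curl u x + alpha x *: u x)) /\
     (forall B, sumset D (beltrami D lambda1) (beltrami D lambda2) B ->
        double_beltrami_eqs D alpha beta
          (fun x => curl B x - beta x *: B x) B)) /\
  (forall alpha beta : 'rV[R]_3 -> R,
     C1 D alpha -> C1 D beta ->
     constant_on D (fun x => alpha x - beta x) ->
     (forall x, points D x -> 2 < `|alpha x - beta x|) ->
     let lambda1 := fun x =>
       (alpha x + beta x + Num.sqrt ((alpha x - beta x) ^+ 2 - 4)) / 2 in
     let lambda2 := fun x =>
       (alpha x + beta x - Num.sqrt ((alpha x - beta x) ^+ 2 - 4)) / 2 in
     (forall x, points D x -> lambda1 x <> lambda2 x) /\
     (forall u B, double_beltrami_state D alpha beta u B ->
        sumset D (beltrami D lambda1) (beltrami D lambda2) u /\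
        sumset D (beltrami D lambda1) (beltrami D lambda2) B)) /\
  (forall alpha beta : 'rV[R]_3 -> R,
     C1 D alpha -> C1 D beta ->
     constant_on D (fun x => alpha x - beta x) ->
     (forall x, points D x -> `|alpha x - beta x| = 2) ->
     let lambda := fun x => (alpha x + beta x) / 2 in
     forall u B, torus_or_zero_boundary D u B ->
       double_beltrami_state D alpha beta u B ->
       beltrami D lambda u /\ beltrami D lambda B).
Proof.
split; [|split].
- move=> lambda1 lambda2 _ _ [c cE] alpha beta.
  have r2 : Num.sqrt (c ^+ 2 + 4) ^+ 2 = c ^+ 2 + 4.
    by rewrite sqr_sqrtr// addr_ge0// sqr_ge0.
  (* The constants are alpha - lambda1 and alpha - lambda2, with c = lambda1 - lambda2. *)
  apply: (@superposition_double_beltrami _ _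
    ((Num.sqrt (c ^+ 2 + 4) - c) / 2) ((Num.sqrt (c ^+ 2 + 4) + c) / 2)).
    transitivity ((Num.sqrt (c ^+ 2 + 4) ^+ 2 - c ^+ 2) / 4); first by field.
    by rewrite r2; field.
  move=> x Dx; rewrite /alpha /beta cE//.
  have -> : lambda1 x = lambda2 x + c by rewrite -(cE x Dx); ring.
  by split; field.
- move=> alpha beta _ _ [c cE] gap lambda1 lambda2.
  have r0 x : points D x -> 0 < Num.sqrt (c ^+ 2 - 4).
    move=> Dx; rewrite sqrtr_gt0 subr_gt0 -real_normK ?num_real//.
    have := gap x Dx; rewrite cE// => c2.
    by rewrite (_ : 4 = 2 ^+ 2 :> R) ?ltr_pXn2r ?nnegrE//; ring.
  split=> [x Dx|u B uB].
    rewrite /lambda1 /lambda2 cE// => E; have := r0 x Dx; lra.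
  (* That [alpha] is not identically zero supplies a point of the domain, at which the gap condition
     becomes a condition on the constant [c]. *)
  have [[x Dx _] _ _ _] := uB; have {r0} r0 := r0 x Dx.
  have r2 : Num.sqrt (c ^+ 2 - 4) ^+ 2 = c ^+ 2 - 4.
    by rewrite sqr_sqrtr// ltW// -sqrtr_gt0.
  (* Again p = alpha - lambda1 and q = alpha - lambda2, now with c = alpha - beta; they differ by
     the positive square root. *)
  apply: (@double_beltrami_superposition _ _ ((c - Num.sqrt (c ^+ 2 - 4)) / 2)
    ((c + Num.sqrt (c ^+ 2 - 4)) / 2) alpha beta) => //.
  + transitivity ((c ^+ 2 - Num.sqrt (c ^+ 2 - 4) ^+ 2) / 4); first by field.
    by rewrite r2; field.
  + by apply/eqP => E; lra.
  + move=> y Dy; rewrite /lambda1 /lambda2 cE//.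
    have -> : alpha y = beta y + c by rewrite -(cE y Dy); ring.
    by split; field.
- move=> alpha beta _ _ [c cE] gap lambda u B bd uB.
  have [[x Dx _] _ _ _] := uB.
  apply: (@double_beltrami_critical _ _ (c / 2) alpha beta) bd uB.
    transitivity (`|c| ^+ 2 / 4); last by rewrite -(cE x Dx) gap//; field.
    by rewrite real_normK ?num_real//; field.
  move=> y Dy; rewrite /lambda.
  have -> : alpha y = beta y + c by rewrite -(cE y Dy); ring.
  by split; field.
Qed.
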